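(* Let $X$ be a flat Hadamard space with linear dual space $X^{\lozenge}$ and let $M \subseteq X \times X^{\lozenge}$. Then $M$ is a monotone set if and only if $\Theta_M=\varsigma_M$.
   Context: A geodesic path from $x$ to $y$ in a metric space $(X,d)$ is a map $c:[0,1]\to X$ with $c(0)=x$, $c(1)=y$ and $d(c(t),c(s))=|t-s|d(x,y)$ for all $t,s$. An Hadamard space is a complete (nonempty) CAT(0) space, i.e. a complete metric space in which any two points are joined by a geodesic path and which satisfies the CN-inequality $d(z,(1-\lambda)x\oplus \lambda y)^2 \leq (1-\lambda)d(z,x)^2 +\lambda d(z,y)^2-\lambda(1-\lambda)d(x,y)^2$ for all $x,y,z\in X$, $\lambda\in[0,1]$. In such a space geodesics are unique, and $(1-\lambda)x\oplus\lambda y$ denotes $c(\lambda)$ for the geodesic path $c$ from $x$ to $y$. The space is flat if equality holds in the CN-inequality for all $x,y,z\in X$, $\lambda\in[0,1]$. For points $v_1,\dots,v_n$ and weights $\lambda_i\in(0,1)$ with $\sum\lambda_i=1$, the convex combination is defined inductively by $\bigoplus_{i=1}^n\lambda_iv_i=(1-\lambda_n)\big(\bigoplus_{i=1}^{n-1}\frac{\lambda_i}{1-\lambda_n}v_i\big)\oplus\lambda_nv_n$; for $n=1$ (weight $1$) it is $v_1$. Bound vectors: $\overrightarrow{xy}$ denotes $(x,y)\in X^2$, and $\langle \overrightarrow{ab}, \overrightarrow{cd} \rangle=\frac12\{d(a,d)^2+d(b,c)^2-d(a,c)^2-d(b,d)^2\}$ for $a,b,c,d\in X$. Dual spaces: for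 $t\in\mathbb{R}$, $a,b\in X$, $[t\overrightarrow{ab}]$ is the class of $(t,a,b)$ under $(t,a,b)\sim(s,c,d)$ iff $t\langle\overrightarrow{ab},\overrightarrow{xy}\rangle=s\langle\overrightarrow{cd},\overrightarrow{xy}\rangle$ for all $x,y\in X$; it acts on $X^2$ by $\langle[t\overrightarrow{ab}],\overrightarrow{xy}\rangle=t\langle\overrightarrow{ab},\overrightarrow{xy}\rangle$. $X^*$ is the set of these classes, viewed as real functions on $X^2$, and $X^{\lozenge}=\operatorname{span}X^*$ is the linear dual space, whose elements act linearly: $\langle\sum_i\alpha_ix_i^*,\overrightarrow{xy}\rangle=\sum_i\alpha_i\langle x_i^*,\overrightarrow{xy}\rangle$ (elements are identified when they agree as functions on $X^2$). $M\subseteq X\times X^{\lozenge}$ is monotone if $\langle x^{\lozenge}-y^{\lozenge},\overrightarrow{yx}\rangle\ge0$ for all $(x,x^{\lozenge}),(y,y^{\lozenge})\in M$. $\varsigma_M$ is the set of functions $\eta:M\to[0,+\infty)$ with finite support and $\sum_{m\in M}\eta(m)=1$. For $\eta\in\varsigma_M$, let $(x_1,x_1^{\lozenge}),\dots,(x_n,x_n^{\lozenge})$ be the elements of the support of $\eta$ (in an enumeration fixed once and for all for each $\eta$) and $\lambda_i=\eta(x_i,x_i^{\lozenge})$; put $\alpha(\eta)=\bigoplus_{i=1}^n\lambda_ix_i\in X$, $\beta(\eta)=\sum_{i=1}^n\lambda_ix_i^{\lozenge}\in X^{\lozenge}$, and, for $p\in X$, $\theta_p(\eta)=\sum_{i=1}^n\lambda_i\langle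 x_i^{\lozenge},\overrightarrow{px_i}\rangle$. Set $\Theta_{p,M}=\{\eta\in\varsigma_M:\theta_p(\eta)\ge\langle\beta(\eta),\overrightarrow{p\alpha(\eta)}\rangle\}$. This set does not depend on $p\in X$ and is denoted $\Theta_M$. *)

(* Defs.v *)
From HB Require Import structures.
From mathcomp Require Import all_boot all_order all_algebra.
From mathcomp Require Import all_classical all_reals all_analysis.
From mathcomp Require Import ring lra.
Set Implicit Arguments.
Unset Strict Implicit.
Unset Printing Implicit Defensive.
Import Order.TTheory GRing.Theory Num.Theory.
Import numFieldNormedType.Exports.
Local Open Scope classical_set_scope.
Local Open Scope ring_scope.

(* [Complete] structures are pointed, hence nonempty. *)
#[short(type="completeMetricType")]
HB.structure Definition CompleteMetric (R : numDomainType) :=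
  {T of Metric R T & Complete T}.

(* Geodesic paths are total functions on [R] of which only the restriction to
   the unit interval matters. *)
Definition geodesic (R : realType) (X : metricType R) (x y : X) (c : R -> X) :=
  [/\ c 0 = x, c 1 = y &
   forall t s : R, 0 <= t <= 1 -> 0 <= s <= 1 ->
     mdist (c t) (c s) = `|t - s| * mdist x y].

Definition cn_bound (R : realType) (X : metricType R) (x y z : X) (l : R) : R :=
  (1 - l) * mdist z x ^+ 2 + l * mdist z y ^+ 2
  - l * (1 - l) * mdist x y ^+ 2.

HB.mixin Record CompleteMetric_isHadamard (R : realType) X
    & CompleteMetric R X := {
  geodesic_ex : forall x y : X, exists c : R -> X, geodesic x y c ;
  cn_inequality : forall (x y z : X) (c : R -> X) (l : R),
    geodesic x y c -> 0 <= l <= 1 -> mdist z (c l) ^+ 2 <= cn_bound x y z l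
}.

#[short(type="hadamardType")]
HB.structure Definition Hadamard (R : realType) :=
  {X of CompleteMetric R X & CompleteMetric_isHadamard R X}.

(* (1 - l) x (+) l y; by [geoconvE] below, the choice is forced when
   [0 <= l <= 1]. *)
Definition geoconv (R : realType) (X : hadamardType R) (l : R) (x y : X) : X :=
  xget x [set z | exists2 c : R -> X, geodesic x y c & z = c l].

Lemma geodesic_unique (R : realType) (X : hadamardType R) (x y : X)
    (c c' : R -> X) (l : R) :
  geodesic x y c -> geodesic x y c' -> 0 <= l <= 1 -> c l = c' l.
Proof.
move=> gc gc' l01; case: (gc) => c0 c1 dc; apply: mdist_positivity.
have h0 : 0 <= (0 : R) <= 1 by rewrite lexx ler01.
have h1 : 0 <= (1 : R) <= 1 by rewrite lexx ler01.
have dx : mdist (c l) x = `|l - 0| * mdist x y by rewrite -dc// c0.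
have dy : mdist (c l) y = `|l - 1| * mdist x y by rewrite -dc// c1.
have := @cn_inequality R X x y (c l) c' l gc' l01.
rewrite /cn_bound dx dy !exprMn !real_normK ?num_real// => le0.
apply/eqP; rewrite -sqrf_eq0 eq_le sqr_ge0 andbT.
by apply: le_trans le0 _; rewrite le_eqVlt; apply/orP; left; apply/eqP; ring.
Qed.

Lemma geoconvE (R : realType) (X : hadamardType R) (x y : X) (c : R -> X)
    (l : R) :
  geodesic x y c -> 0 <= l <= 1 -> geoconv l x y = c l.
Proof.
move=> gc l01; apply: xget_unique; first by exists c.
by move=> _ [c' gc' ->]; exact: geodesic_unique gc' gc l01.
Qed.

Definition flat (R : realType) (X : hadamardType R) :=
  forall (x y z : X) (l : R), 0 <= l <= 1 ->
    mdist z (geoconv l x y) ^+ 2 = cn_bound x y z l.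

(* Convex combination of [v 0, ..., v n.-1] with weights [l 0, ..., l n.-1];
   the value for [n = 0] is junk. *)
Fixpoint convcomb (R : realType) (X : hadamardType R) (n : nat)
    (l : nat -> R) (v : nat -> X) : X :=
  match n with
  | 0 => point
  | 1 => v 0%N
  | n'.+1 => geoconv (l n') (convcomb n' (fun i => l i / (1 - l n')) v) (v n')
  end.

(* The bound vector from [a] to [b] is the pair [(a, b)]. *)
Definition quasilin (R : realType) (X : metricType R) (ab cd : X * X) : R :=
  2^-1 * (mdist ab.1 cd.2 ^+ 2 + mdist ab.2 cd.1 ^+ 2
          - mdist ab.1 cd.1 ^+ 2 - mdist ab.2 cd.2 ^+ 2).

(* The class of [(t, a, b)] is represented by the function on [X * X] it
   induces: two triples are equivalent iff these functions are equal. *)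
Definition dual (R : realType) (X : metricType R) : set (X * X -> R) :=
  [set f | exists (t : R) (ab : X * X), f = fun xy => t * quasilin ab xy].
Arguments dual {R} X _.

Definition lspan (R : pzRingType) (V : lmodType R) (S : set V) : set V :=
  [set v | exists s : seq (R * V),
    {in s, forall p, S p.2} /\ v = \sum_(p <- s) p.1 *: p.2].

Definition lindual_pred (R : realType) (X : metricType R) :
  {pred X * X -> R} := fun f => `[< lspan (dual X) f >].

Lemma lindual_closed (R : realType) (X : metricType R) :
  submod_closed (@lindual_pred R X).
Proof.
split; first by apply/asboolP; exists [::]; rewrite big_nil.
move=> a f g /asboolP[s [Ss ->]] /asboolP[t [St ->]]; apply/asboolP.
exists ([seq (a * p.1, p.2) | p <- s] ++ t); split.
  move=> p; rewrite mem_cat => /orP[/mapP[q qs ->]|]; last exact: St.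
  exact: (Ss q qs).
rewrite big_cat big_map scaler_sumr; congr (_ + _).
by apply: eq_bigr => p _; rewrite scalerA.
Qed.

HB.instance Definition _ (R : realType) (X : metricType R) :=
  GRing.isSubmodClosed.Build R (X * X -> R) (@lindual_pred R X)
    (@lindual_closed R X).

(* The linear dual space; [x (a, b)] is the pairing of [x : lindual X] with the
   bound vector from [a] to [b]. *)
Record lindual (R : realType) (X : metricType R) := LinDual {
  lindual_fun :> X * X -> R ;
  _ : lindual_fun \in @lindual_pred R X
}.

HB.instance Definition _ (R : realType) (X : metricType R) :=
  [isSub for @lindual_fun R X].
HB.instance Definition _ (R : realType) (X : metricType R) :=
  [Choice of @lindual R X by <:].
HB.instance Definition _ (R : realType) (X : metricType R) :=
  [SubChoice_isSubLmodule of @lindual R X by <:].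

Definition monotone_set (R : realType) (X : metricType R)
    (M : set (X * lindual X)) :=
  forall m m', M m -> M m' -> 0 <= (m.2 - m'.2) (m'.1, m.1).

Section varsigma.
Variables (R : realType) (X : hadamardType R) (M : set (X * lindual X)).

Definition varsigma : set (M -> R) :=
  [set eta | [/\ forall m : M, 0 <= eta m, finite_set [set m | eta m != 0] &
              \sum_(m \in [set: M]) eta m = 1]].

Definition support_enumeration (enum : (M -> R) -> seq M) :=
  forall eta, varsigma eta ->
    uniq (enum eta) /\ forall m, (m \in enum eta) = (eta m != 0).

Variable enum : (M -> R) -> seq M.

Definition alpha (eta : M -> R) : X :=
  convcomb (size (enum eta)) (nth 0 [seq eta m | m <- enum eta])
    (nth point [seq (val m).1 | m <- enum eta]).

Definition beta (eta : M -> R) : lindual X :=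
  \sum_(m <- enum eta) eta m *: (val m).2.

Definition theta (p : X) (eta : M -> R) : R :=
  \sum_(m <- enum eta) eta m * (val m).2 (p, (val m).1).

Definition Theta (p : X) : set (M -> R) :=
  [set eta | varsigma eta /\ beta eta (p, alpha eta) <= theta p eta].

End varsigma.

Arguments varsigma {R X} M _.

(* Main.v *)
(* In a flat space every element of the linear dual is affine along geodesics
   in its second point, so [theta_p eta - <beta eta, p (alpha eta)>] equals
   half of the sum over pairs [m, m'] in the support of
   [eta m * eta m' * <x_m^* - x_m'^*, x_m' x_m>].  Each term is nonnegative when
   [M] is monotone; conversely, weights 1/2, 1/2 on two points isolate a
   single term. *)
Require Import Defs.
From mathcomp Require Import all_boot all_order all_algebra.
From mathcomp Require Import all_classical all_reals all_analysis.
From mathcomp Require Import ring lra.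
Import Order.TTheory GRing.Theory Num.Theory.
Local Open Scope classical_set_scope.
Local Open Scope ring_scope.

Section LinearDual.
Variables (R : realType) (X : metricType R).
Implicit Types f : lindual X.

(** The span coefficient and the scalar inside each dual element merge into one, so identities on
    the linear dual reduce to identities for [quasilin]. *)
Lemma lindual_repr f : exists s : seq (R * (X * X)),
  forall ab, f ab = \sum_(p <- s) p.1 * quasilin p.2 ab.
Proof.
case: f => f /= /asboolP[s [Ss ->]].
elim: s Ss => [|[a g] s IH] Ss; first by exists [::] => ab; rewrite !big_nil.
have [p ps|r Er] := IH; first by apply: Ss; rewrite inE ps orbT.
have [/= t [cd gE]] := Ss (a, g) (mem_head _ _).
exists ((a * t, cd) :: r) => ab.
by rewrite !big_cons /= -Er gE -mulrA.
Qed.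

(** For a single [quasilin] the squared distances to the intermediate point [b] cancel. *)
Lemma lindualD f (a b c : X) : f (a, c) = f (a, b) + f (b, c).
Proof.
have [s Es] := lindual_repr f; rewrite !Es -big_split /=.
by apply: eq_bigr => -[t [u v]] _; rewrite /quasilin /=; ring.
Qed.

Lemma lindual_subr f (p x y : X) : f (p, x) - f (p, y) = f (y, x).
Proof. by rewrite (lindualD f p y x) addrC addKr. Qed.

Lemma lindualN f (x y : X) : f (x, y) = - f (y, x).
Proof. by rewrite -(lindual_subr f x x y) opprB lindual_subr. Qed.

Lemma lindual_sub_swap f g (x y : X) : (f - g) (x, y) = (g - f) (y, x).
Proof. by rewrite lindualN -opprB /= opprK. Qed.

Lemma lindual_sumE (I : Type) (s : seq I) (a : I -> R) (F : I -> lindual X) ab :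
  (\sum_(i <- s) a i *: F i) ab = \sum_(i <- s) a i * F i ab.
Proof.
by elim: s => [|i s IH]; rewrite ?big_nil // !big_cons -IH.
Qed.

End LinearDual.

Section FlatSpace.
Variables (R : realType) (X : hadamardType R).
Hypothesis flatX : flat X.

(** The second endpoint enters [quasilin (u, v)] only through a difference of squared distances to
    [u] and [v]. By flatness each is affine up to the same term in [mdist x y], which cancels. *)
Lemma lindual_geoconv (f : lindual X) (p x y : X) (l : R) : 0 <= l <= 1 ->
  f (p, geoconv l x y) = (1 - l) * f (p, x) + l * f (p, y).
Proof.
move=> l01; have [s Es] := lindual_repr _ _ f; rewrite !Es !mulr_sumr -big_split /=.
apply: eq_bigr => -[t [u v]] _.
by rewrite /quasilin /= !flatX // /cn_bound; field.
Qed.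

Lemma lindual_convcomb (f : lindual X) (p : X) n (l : nat -> R) (v : nat -> X) :
  (forall i, (i < n)%N -> 0 < l i) -> \sum_(i < n) l i = 1 ->
  f (p, convcomb n l v) = \sum_(i < n) l i * f (p, v i).
Proof.
elim: n l => [|[|n] IH] l l_gt0 suml.
(* The junk value at length 0 is excluded: an empty sum is not 1. *)
- by move: suml; rewrite big_ord0 => /eqP; rewrite eq_sym oner_eq0.
- by move: suml; rewrite !big_ord1 => ->; rewrite mul1r.
rewrite big_ord_recr /=.
have sumE : \sum_(i < n.+1) l i = 1 - l n.+1.
  by apply/eqP; rewrite eq_sym subr_eq -suml big_ord_recr.
(* This is the total of the remaining positive weights, so the renormalising division in [convcomb]
   is legitimate. *)
have pos : 0 < 1 - l n.+1.
  rewrite -sumE big_ord_recl ltr_wpDr ?l_gt0 //.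
  by apply: sumr_ge0 => i _; exact/ltW/l_gt0/leqW/ltn_ord.
have := l_gt0 n.+1 (ltnSn _) => ln_gt0.
rewrite -/(convcomb n.+1 _ v) lindual_geoconv; last by apply/andP; split; lra.
rewrite IH; last 2 first.
- by move=> i i_n; rewrite divr_gt0 // l_gt0 // ltnW.
- by rewrite -mulr_suml sumE divff // gt_eqF.
congr (_ + _); rewrite mulr_sumr; apply: eq_bigr => i _.
by rewrite mulrA mulrCA divff ?mulr1 // gt_eqF.
Qed.

Variables (M : set (X * lindual X)) (enum : (M -> R) -> seq M).
Hypothesis henum : support_enumeration enum.

Lemma fsbig_seq_support (eta : M -> R) (s : seq M) : uniq s ->
  (forall m, eta m != 0 -> m \in s) ->
  \sum_(m \in [set: M]) eta m = \sum_(m <- s) eta m.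
Proof.
move=> us supp; rewrite (fsbigE s) // => [|m _ ms].
  by apply: eq_bigl => m; rewrite in_setT.
by apply/eqP; apply: contraNT ms; exact: supp.
Qed.

(** Affineness expands the pairing at [alpha] into a double sum, and subtracting two pairings based
    at [p] eliminates [p]. *)
Lemma theta_sub_beta (eta : M -> R) (p : X) : varsigma M eta ->
  theta enum p eta - beta enum eta (p, alpha enum eta) =
  \sum_(m <- enum eta) \sum_(m' <- enum eta)
    eta m * eta m' * (val m).2 ((val m').1, (val m).1).
Proof.
move=> eta_sigma; have [eta_ge0 _ eta1] := eta_sigma.
have [ue memE] := henum _ eta_sigma.
have sum1 : \sum_(m <- enum eta) eta m = 1.
  by rewrite -fsbig_seq_support // => m; rewrite memE.
have alphaE (f : lindual X) :
    f (p, alpha enum eta) = \sum_(m <- enum eta) eta m * f (p, (val m).1).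
  have nthE (F : M -> R) : \sum_(m <- enum eta) F m =
      \sum_(i < size (enum eta)) F (tnth (in_tuple (enum eta)) i).
    by rewrite big_tnth.
  have wE (i : 'I_(size (enum eta))) : nth 0 [seq eta m | m <- enum eta] i
      = eta (tnth (in_tuple (enum eta)) i).
    rewrite (tnth_nth (tnth (in_tuple (enum eta)) i)).
    by rewrite (nth_map (tnth (in_tuple (enum eta)) i)).
  rewrite /alpha lindual_convcomb.
  - rewrite nthE; apply: eq_bigr => i _; rewrite wE; congr (_ * f (p, _)).
    rewrite (tnth_nth (tnth (in_tuple (enum eta)) i)).
    by rewrite (nth_map (tnth (in_tuple (enum eta)) i)).
  (* Weights are strictly positive because only support points are enumerated. *)
  - move=> i ilt; rewrite (wE (Ordinal ilt)) lt_neqAle eta_ge0 andbT eq_sym.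
    by rewrite -memE mem_tnth.
  - by rewrite -sum1 nthE; apply: eq_bigr => i _; rewrite wE.
rewrite /theta /beta lindual_sumE -sumrB; apply: eq_bigr => m _.
(* Writing 1 as the total weight turns the [theta] term into a sum over [m'] as well. *)
rewrite alphaE -mulrBr -[X in X - _]mul1r -sum1 mulr_suml -sumrB mulr_sumr.
by apply: eq_bigr => m' _; rewrite -mulrBr lindual_subr mulrA.
Qed.

(** The double sum is added to its copy with [m] and [m'] exchanged; antisymmetry of the pairing
    produces the differences that monotonicity controls. *)
Lemma theta_sub_beta_sym (eta : M -> R) (p : X) : varsigma M eta ->
  2 * (theta enum p eta - beta enum eta (p, alpha enum eta)) =
  \sum_(m <- enum eta) \sum_(m' <- enum eta)
    eta m * eta m' * ((val m).2 - (val m').2) ((val m').1, (val m).1).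
Proof.
move=> eta_sigma; rewrite theta_sub_beta // mulr_natl mulr2n.
rewrite [X in _ + X]exchange_big -big_split /=; apply: eq_bigr => m _.
rewrite -big_split /=; apply: eq_bigr => m' _.
rewrite [eta m' * _]mulrC -mulrDr; congr (_ * _).
by rewrite (lindualN _ _ (val m').2).
Qed.

Lemma varsigma_midpoint (m m' : M) : m != m' ->
  varsigma M (fun k => if k \in [:: m; m'] then 2^-1 else 0).
Proof.
move=> mm'; have us : uniq [:: m; m'] by rewrite /= inE mm'.
split.
- by move=> k; case: ifP => // _; rewrite invr_ge0.
- apply: (sub_finite_set _ (finite_seq [:: m; m'])) => k /=.
  by case: ifP => //; rewrite eqxx.
- rewrite (fsbig_seq_support _ [:: m; m']) // => [|k].
    by rewrite !big_cons big_nil !inE !eqxx orbT /= addr0; field.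
  by case: ifP => //; rewrite eqxx.
Qed.

End FlatSpace.

Theorem corollary3p5 (R : realType) (X : hadamardType R) (hflat : flat X)
    (M : set (X * lindual X)) (enum : (M -> R) -> seq M)
    (henum : support_enumeration enum) (p : X) :
  monotone_set M <-> Theta enum p = varsigma M.
Proof.
split => [monoM|ThetaE m m' Mm Mm'].
  apply/seteqP; split => [eta []//|eta eta_sigma]; split => //.
  have [eta_ge0 _ _] := eta_sigma.
  rewrite -subr_ge0 -(@pmulr_rge0 _ 2) // theta_sub_beta_sym //.
  apply: sumr_ge0 => m _; apply: sumr_ge0 => m' _.
  by rewrite !mulr_ge0 //; apply: monoM; exact: set_valP.
pose u : M := SigSub (mem_set Mm); pose u' : M := SigSub (mem_set Mm').
(* Two weights 1/2 have total 1 only on distinct points; for equal points the difference of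
   functionals vanishes. *)
have [uu'|uu'] := eqVneq u u'.
  by have -> : m = m' by [exact: (congr1 val uu')]; rewrite subrr.
pose eta k : R := if k \in [:: u; u'] then 2^-1 else 0.
have eta_sigma : varsigma M eta := varsigma_midpoint _ _ _ _ _ uu'.
have : Theta enum p eta by rewrite ThetaE.
case=> _; rewrite -subr_ge0 -(@pmulr_rge0 _ 2) // theta_sub_beta_sym //.
have [ue memE] := henum _ eta_sigma.
(* The order chosen by [enum] is unknown, but the sums do not depend on it. *)
have enumE : perm_eq (enum eta) [:: u; u'].
  apply: uniq_perm => [//||k]; first by rewrite /= inE uu'.
  rewrite memE /eta; case: ifP => _; last by rewrite eqxx.
  by rewrite invr_eq0 pnatr_eq0.
under eq_bigr do rewrite (perm_big _ enumE).
rewrite (perm_big _ enumE) !big_cons !big_nil /= !addr0.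
have -> : eta u = 2^-1 by rewrite /eta mem_head.
have -> : eta u' = 2^-1 by rewrite /eta !inE eqxx orbT.
(* Diagonal terms vanish; the two cross terms, each of weight 1/4, are equal by
   [lindual_sub_swap]. *)
rewrite !subrr !mulr0 add0r addr0.
have half (a b : R) : b = a -> 0 <= 2^-1 / 2 * a + 2^-1 / 2 * b -> 0 <= a.
  by move=> ->; lra.
by apply: half; exact: lindual_sub_swap.
Qed.
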